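(* Let $f=(f_1,\dots,f_q):\mathbf{R}^n\to\mathbf{R}^q$ be a vector polynomial with $\deg f_i=d_i\ge 1$ for $i=1,\dots,q$, let $\mathbf{d}=(d_1,\dots,d_q)$, and let $S\subseteq\mathbf{R}^n$ be a nonempty closed set. The following are equivalent: (i) $SOL^{w}(S_\infty,f^\infty_{\mathbf d})=\{0\}$; (ii) $SOL(S_\infty,(f_i)^\infty_{d_i})=\{0\}$ for all $i\in\{1,\dots,q\}$; (iii) $SOL(S_\infty,\{\sum_{i=1}^q\lambda_i f_i\}^\infty_d)=\{0\}$ for every $\lambda=(\lambda_1,\dots,\lambda_q)\in\mathbf{R}^q_+\setminus\{0\}$. Moreover, if $S$ satisfies $S_\infty\subseteq\{x\in\mathbf{R}^n: f^\infty_{\mathbf d}(x)\le 0\}$, then (i)-(iii) are also equivalent to (iv) $SOL^{s}(S_\infty,f^\infty_{\mathbf d})=\{0\}$. In addition, if one of the conditions (i)-(iv) holds, then there exists $\lambda=(\lambda_1,\dots,\lambda_q)\in\mathbf{R}^q_+\setminus\{0\}$ such that $SOL(S_\infty,\{\sum_{i=1}^q\lambda_i f_i\}^\infty_d)=\{0\}$.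
   Context: $\mathbf{R}^q_+$ is the nonnegative orthant; $y\le z$ in $\mathbf{R}^q$ means $z-y\in\mathbf{R}^q_+$. The asymptotic cone of a nonempty closed set $S$ is $S_\infty=\{v\in\mathbf{R}^n:\exists\, t_k\to+\infty,\ x_k\in S \text{ with } x_k/t_k\to v\}$. For a polynomial $p$ of degree $d$, $p^\infty_d(x)=\lim_{t\to+\infty}p(tx)/t^d$ (its leading homogeneous part), and $f^\infty_{\mathbf d}=((f_1)^\infty_{d_1},\dots,(f_q)^\infty_{d_q})$. In $\{\sum_{i=1}^q\lambda_i f_i\}^\infty_d$ the index is $d=\deg\sum_{i=1}^q\lambda_i f_i$. For a set $A\subseteq\mathbf{R}^n$, $SOL(A,p)$ is the set of global minimizers of the scalar function $p$ over $A$. For $g:\mathbf{R}^n\to\mathbf{R}^q$: $SOL^{s}(A,g)=\{x^*\in A: g(x)-g(x^* )\notin-\mathbf{R}^q_+\setminus\{0\}\ \forall x\in A\}$ (Pareto efficient solutions) and $SOL^{w}(A,g)=\{x^*\in A: g(x)-g(x^* )\notin-\operatorname{int}\mathbf{R}^q_+\ \forall x\in A\}$ (weak Pareto efficient solutions).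
   Formalization: In the last claim, condition (iv) is taken together with S_∞ ⊆ {f^∞_d ≤ 0}; with (iv) alone the claim fails, e.g. for S = R²_+ and f = (x, y²); conditions (i)-(iii) need no such assumption. *)

(* Defs.v *)
From HB Require Import structures.
From mathcomp Require Export all_boot all_order all_algebra.
From mathcomp Require Export all_classical all_reals all_analysis.
From mathcomp Require mpoly.
Import (canonicals, coercions) mpoly.
Export numFieldNormedType.Exports.
Export Order.TTheory GRing.Theory Num.Theory.

Set Implicit Arguments.
Unset Strict Implicit.
Unset Printing Implicit Defensive.

Local Open Scope classical_set_scope.
Local Open Scope ring_scope.

(* The notations of mpoly clash with those of the analysis library: only its
   canonical structures and coercions are imported, its names stay qualified. *)

Definition peval (R : realType) (n : nat) (p : mpoly.mpoly n R)
    (x : 'rV[R]_n) : R :=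
  mpoly.meval (fun j => x ord0 j) p.

(* [msize p] is 1 plus the total degree of [p], and 0 for [p = 0]; hence the
   zero polynomial gets degree 0. *)
Definition pdeg (R : realType) (n : nat) (p : mpoly.mpoly n R) : nat :=
  (mpoly.msize p).-1.

(* [lim] is a total operator, but the limit does exist whenever
   [pdeg p <= d]: see [pinf_cvg] and [pinfE]. *)
Definition pinf (R : realType) (n : nat) (p : mpoly.mpoly n R) (d : nat)
    (x : 'rV[R]_n) : R :=
  lim (peval p (t *: x) / t ^+ d @[t --> +oo]).

Lemma pinf_cvg (R : realType) (n : nat) (p : mpoly.mpoly n R) (d : nat)
    (x : 'rV[R]_n) : (pdeg p <= d)%N ->
  peval p (t *: x) / t ^+ d @[t --> +oo] -->
    peval (mpoly.pihomog mpoly.mdeg d p) x.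
Proof.
move=> pd.
pose mon (m : mpoly.multinom n) := \prod_i x ord0 i ^+ m i.
have le_md m : m \in mpoly.msupp p -> (mpoly.mdeg m <= d)%N.
  move=> /mpoly.msize_mdeg_lt lt_m; rewrite -ltnS (leq_trans lt_m)//.
  by rewrite (leq_trans (leqSpred _))// ltnS.
have -> : peval (mpoly.pihomog mpoly.mdeg d p) x =
    \sum_(m <- mpoly.msupp p)
       mpoly.mcoeff m p * mon m * 0 ^+ (d - mpoly.mdeg m)%N.
  rewrite /peval /mpoly.pihomog raddf_sum /= big_mkcond /= !big_seq.
  apply: eq_bigr => m /le_md md.
  case: eqP => [->|/eqP neq].
    by rewrite subnn expr0 mulr1 mpoly.mevalZ mpoly.mevalX.
  by rewrite expr0n subn_eq0 leqNgt ltn_neqAle neq md /= mulr0.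
have inv0 : (t : R)^-1 @[t --> +oo] --> (0 : R).
  by apply/gtr0_cvgV0; [exact: nbhs_pinfty_gt|exact: cvg_id].
apply: cvg_trans (_ : (\sum_(m <- mpoly.msupp p)
    mpoly.mcoeff m p * mon m * t^-1 ^+ (d - mpoly.mdeg m)%N) @[t --> +oo] --> _).
  apply: near_eq_cvg; near=> t.
  have t0 : t != 0 by rewrite gt_eqF//; near: t; exact: nbhs_pinfty_gt.
  rewrite /peval mpoly.mevalE mulr_suml !big_seq; apply: eq_bigr => m /le_md md.
  rewrite -!mulrA; congr (_ * _).
  under [in RHS]eq_bigr do rewrite mxE exprMn.
  rewrite big_split /= prodrXr -mpoly.mdegE mulrAC mulrC; congr (_ * _).
  by rewrite -{2}(subnK md) exprD invfM mulrCA divff ?expf_neq0// mulr1 exprVn.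
apply: cvg_big => [|m _]; first exact: add_continuous.
apply: cvgM; first exact: cvg_cst.
exact: (cvg_comp _ (fun u : R => u ^+ (d - mpoly.mdeg m)%N) inv0
  (@exprn_continuous R _ 0)).
Unshelve. all: by end_near.
Qed.

Lemma pinfE (R : realType) (n : nat) (p : mpoly.mpoly n R) (d : nat)
    (x : 'rV[R]_n) : (pdeg p <= d)%N ->
  pinf p d x = peval (mpoly.pihomog mpoly.mdeg d p) x.
Proof. by move=> /pinf_cvg pd; apply: norm_cvg_lim; exact: pd. Qed.

Definition vinf (R : realType) (n q : nat) (f : 'I_q -> mpoly.mpoly n R)
    (d : 'I_q -> nat) (x : 'rV[R]_n) : 'rV[R]_q :=
  \row_i pinf (f i) (d i) x.

Definition asymptotic_cone (R : realType) (n : nat) (S : set 'rV[R]_n) :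
    set 'rV[R]_n :=
  [set v | exists (t : nat -> R) (x : nat -> 'rV[R]_n),
     [/\ t k @[k --> \oo] --> +oo,
         forall k, S (x k) &
         (t k)^-1 *: x k @[k --> \oo] --> v]].

Definition orthant (R : realType) (q : nat) : set 'rV[R]_q :=
  [set y | forall i, 0 <= y ord0 i].

Definition vle (R : realType) (q : nat) (y z : 'rV[R]_q) : Prop :=
  orthant (z - y).

Definition SOL (R : realType) (n : nat) (A : set 'rV[R]_n)
    (p : 'rV[R]_n -> R) : set 'rV[R]_n :=
  [set x0 | A x0 /\ forall x, A x -> p x0 <= p x].

Definition SOLs (R : realType) (n q : nat) (A : set 'rV[R]_n)
    (g : 'rV[R]_n -> 'rV[R]_q) : set 'rV[R]_n :=
  [set x0 | A x0 /\
     forall x, A x -> ~ ([set - y | y in @orthant R q] `\ 0) (g x - g x0)].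

Definition SOLw (R : realType) (n q : nat) (A : set 'rV[R]_n)
    (g : 'rV[R]_n -> 'rV[R]_q) : set 'rV[R]_n :=
  [set x0 | A x0 /\
     forall x, A x -> ~ [set - y | y in (@orthant R q)°] (g x - g x0)].

(* Main.v *)
Require Import Defs.
From HB Require Import structures.
From mathcomp Require Import all_boot all_order all_algebra.
From mathcomp Require Import all_classical all_reals all_analysis.
From mathcomp Require mpoly.
Import (canonicals, coercions) mpoly.
Import numFieldNormedType.Exports.
Import Order.TTheory GRing.Theory Num.Theory.

(** The recession functions [g i] of the [f i] are continuous and positively
homogeneous of degree [d i >= 1], so they vanish at 0, and the asymptotic cone
[C] of [S] is a closed cone containing 0.  Everything reduces to one condition:

  (P)  every [g i] is positive on [C] away from 0.

(ii) is (P), because 0 belongs to [C] and [g i 0 = 0] ([SOL_eq_set0P]).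

(iii) gives (ii) by taking for [lambda] the vectors of the canonical basis.
Conversely let [D] be the largest degree of the [f i] with [lambda_i <> 0].
Under (P) the degree [D] part of the weighted sum is, at a nonzero point of [C],
a sum of nonnegative terms one of which is positive; so there is no
cancellation, the sum has degree [D], and its leading part is positive
([scalarization_gt0]).  If [C] is reduced to 0, cancellation may happen but
there is nothing to compare.

(P) implies (i) because 0 then strictly dominates every other point of [C].
The converse is the substantial step ([SOLw_eq_set0P]).  Assume (i).  Since 0 is
weakly efficient, no point of [C] makes all the [g i] negative, hence a nonzero
point with all [g i x <= 0] would be weakly efficient as well, against (i).
By compactness of the unit sphere of [C] and homogeneity, the sublevel sets of
the vector function [g] on [C] are then compact, so that below every point of
[C] lies a weakly efficient one, found by minimizing [\sum_i g i]
([weakly_efficient_below]).  If now [g i x <= 0] for some nonzero [x] of [C],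
then [x], not being weakly efficient, is strictly dominated by some [y], and
a weakly efficient point below [y] has a negative [g i], so it is not 0: a
contradiction.

If [g <= 0] on [C], then (P) says that [C] is reduced to 0, and so does (iv):
if 0 is efficient, then no point of [C] improves on it, so [g] vanishes on [C]
and all points of [C] are efficient ([SOLs_eq_set0P]).

Under any of the conditions, a vector of the canonical basis is a suitable
[lambda], by (iii). *)

Set Implicit Arguments.
Unset Strict Implicit.

Local Open Scope classical_set_scope.
Local Open Scope ring_scope.

(** * Leading forms of polynomials *)

Lemma continuous_sum_fin (R : realType) (T : topologicalType) (I : Type)
    (r : seq I) (h : I -> T -> R) :
  (forall i, continuous (h i)) -> continuous (fun x => \sum_(i <- r) h i x).
Proof.
by move=> hc x; apply: cvg_big => [|i _]; [exact: add_continuous|exact: hc].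
Qed.

Lemma continuous_prod_fin (R : realType) (T : topologicalType) (I : Type)
    (r : seq I) (h : I -> T -> R) :
  (forall i, continuous (h i)) -> continuous (fun x => \prod_(i <- r) h i x).
Proof.
by move=> hc x; apply: cvg_big => [|i _]; [exact: mul_continuous|exact: hc].
Qed.

Lemma peval_continuous (R : realType) (n : nat) (p : mpoly.mpoly n R) :
  continuous (peval p).
Proof.
rewrite (_ : peval p = fun x => \sum_(m <- mpoly.msupp p)
    mpoly.mcoeff m p * \prod_(j < n) x ord0 j ^+ m j); last first.
  by apply/funext => x; rewrite /peval mpoly.mevalE.
apply: continuous_sum_fin => m x.
apply: (@continuousM _ _ (fun=> mpoly.mcoeff m p)
  (fun y : 'rV[R]_n => \prod_(j < n) y ord0 j ^+ m j)).
  exact: cst_continuous.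
apply: continuous_prod_fin => j y.
apply: (continuous_comp (f := fun z : 'rV[R]_n => z ord0 j)
  (g := fun u : R => u ^+ m j)); first exact: coord_continuous.
exact: exprn_continuous.
Qed.

Lemma peval_pihomogZ (R : realType) (n k : nat) (p : mpoly.mpoly n R)
    (t : R) (x : 'rV[R]_n) :
  peval (mpoly.pihomog mpoly.mdeg k p) (t *: x) =
  t ^+ k * peval (mpoly.pihomog mpoly.mdeg k p) x.
Proof.
set P := mpoly.pihomog _ _ _.
have /mpoly.dhomogP homP := mpoly.pihomogP mpoly.mdeg k p.
rewrite /peval !mpoly.mevalE mulr_sumr !big_seq; apply: eq_bigr => m /homP <-.
rewrite mulrCA; congr (_ * _).
under eq_bigr do rewrite mxE exprMn.
by rewrite big_split /= prodrXr -mpoly.mdegE.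
Qed.

Lemma pihomog_gt_pdeg (R : realType) (n k : nat) (p : mpoly.mpoly n R) :
  (pdeg p < k)%N -> mpoly.pihomog mpoly.mdeg k p = 0.
Proof.
move=> pk; rewrite mpoly.pihomogE big_seq_cond big1// => m /andP[mp /eqP mk].
have := mpoly.msize_mdeg_lt mp; rewrite mk => kp; move: pk.
by rewrite /pdeg -(ltn_predK kp) /= ltnNge -ltnS (ltn_predK kp) kp.
Qed.

Lemma pdeg_sum_scale (R : realType) (n q k : nat) (f : 'I_q -> mpoly.mpoly n R)
    (lambda : 'rV[R]_q) :
  (forall i, lambda ord0 i != 0 -> (pdeg (f i) <= k)%N) ->
  (pdeg (\sum_(i < q) lambda ord0 i *: f i)%R <= k)%N.
Proof.
move=> fk; rewrite /pdeg -subn1 leq_subLR add1n.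
apply: (leq_trans (mpoly.msize_sum _ _ _)); apply/bigmax_leqP => i _.
have [->|l0] := eqVneq (lambda ord0 i) 0; first by rewrite scale0r mpoly.msize0.
apply: (leq_trans (mpoly.msizeZ_le _ _)).
by have := fk i l0; rewrite /pdeg -subn1 leq_subLR add1n.
Qed.

(** * The asymptotic cone *)

(** Trading the sequences for approximations at every precision and every scale:
in this form closedness and invariance under scaling need no diagonal
extraction. *)
Lemma asymptotic_coneP (R : realType) (n : nat) (S : set 'rV[R]_n)
    (v : 'rV[R]_n) :
  asymptotic_cone S v <->
  forall e T : R, 0 < e ->
    exists tx : R * 'rV[R]_n, [/\ T < tx.1, S tx.2 & `|v - tx.1^-1 *: tx.2| < e].
Proof.
split=> [[t [x [ty Sx tx]]] e T e0|H].
  have /cvgryPgt/(_ T) Tt := ty.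
  have /cvgrPdist_lt/(_ e e0) te := tx.
  near \oo => k; exists (t k, x k); split=> //=; near: k; [exact: Tt|exact: te].
have /choice[tx txP] k := H (k.+1%:R^-1) k%:R (ltac:(by rewrite invr_gt0)).
exists (fun k => (tx k).1), (fun k => (tx k).2); split.
- apply/cvgryPgt => A; near=> k; have [+ _ _] := txP k.
  by apply: lt_trans; near: k; exact: nbhs_infty_gtr.
- by move=> k; have [] := txP k.
- apply/cvgrPdist_lt => e e0; near=> k; have [_ _] := txP k.
  move=> /lt_trans; apply.
  near: k; have /cvgrPdist_lt/(_ e e0) := @cvg_harmonic R.
  apply: filterS => k /=; rewrite sub0r normrN ger0_norm//.
Unshelve. all: by end_near.
Qed.

Lemma asymptotic_cone_closed (R : realType) (n : nat) (S : set 'rV[R]_n) :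
  closed (asymptotic_cone S).
Proof.
move=> v cv; apply/asymptotic_coneP => e T e0.
have [w [/asymptotic_coneP/(_ (e / 2) T) + vw]] :=
  cv _ (nbhsx_ballx v (e / 2) (divr_gt0 e0 (ltr0Sn R 1))).
case; first by rewrite divr_gt0.
move=> tx [Tt Sx wx]; exists tx; split=> //.
rewrite [e]splitr -[v](subrK w) -addrA (le_lt_trans (ler_normD _ _))// ltrD//.
by move: vw; rewrite -ball_normE.
Qed.

Lemma asymptotic_cone0 (R : realType) (n : nat) (S : set 'rV[R]_n) :
  S !=set0 -> asymptotic_cone S 0.
Proof.
move=> [s Ss]; apply/asymptotic_coneP => e T e0.
pose t := Num.max T (Num.max 1 (`|s| / e)) + 1.
have [Tt t1 te] : [/\ T < t, 1 < t & `|s| / e < t].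
  by rewrite /t !ltr_pwDr// !le_max !lexx ?orbT.
exists (t, s); split=> //=.
have t0 : 0 < t by rewrite (lt_trans ltr01).
rewrite sub0r normrN normrZ ger0_norm ?invr_ge0 ?ltW//.
by rewrite ltr_pdivrMl// -ltr_pdivrMr.
Qed.

Lemma asymptotic_coneZ (R : realType) (n : nat) (S : set 'rV[R]_n) (a : R)
    (v : 'rV[R]_n) :
  0 < a -> asymptotic_cone S v -> asymptotic_cone S (a *: v).
Proof.
move=> a0 /asymptotic_coneP Sv; apply/asymptotic_coneP => e T e0.
have [[t x] /= [Tt Sx vx]] := Sv (e / a) (T * a) (divr_gt0 e0 a0).
(* [a *: v] is approached along the same points of S, with times [t / a]. *)
exists (t / a, x); split=> //=; first by rewrite ltr_pdivlMr.
rewrite invf_div -scalerA -scalerBr normrZ gtr0_norm//.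
by rewrite mulrC -ltr_pdivlMr.
Qed.

(** * Solution sets in coordinates *)

Lemma interior_orthant (R : realType) (q : nat) (y : 'rV[R]_q) :
  (@orthant R q)° y <-> forall i, 0 < y ord0 i.
Proof.
split=> [/nbhs_ballP[e /= e0 ye] i|y0].
  have /ye/(_ i) : ball y e (y - const_mx (e / 2)).
    split=> // i0 j; rewrite -ball_normE /= !mxE opprB addrC subrK.
    by rewrite gtr0_norm ?divr_gt0// ltr_pdivrMr// ltr_pMr// ltr1n.
  by rewrite !mxE subr_ge0; apply: lt_le_trans; rewrite divr_gt0.
exists (fun _ j => [set z : R | 0 < z]) => [i j|z zpos i].
  by rewrite ord1; apply: open_nbhs_nbhs; split; [exact: open_gt|exact: y0].
exact/ltW/zpos.
Qed.

Lemma SOLwP (R : realType) (n q : nat) (A : set 'rV[R]_n)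
    (g : 'rV[R]_n -> 'rV[R]_q) (x0 : 'rV[R]_n) :
  SOLw A g x0 <->
  A x0 /\ forall x, A x -> ~ forall i, g x ord0 i < g x0 ord0 i.
Proof.
split=> -[Ax0 H]; split=> // x Ax Hx; apply: (H x Ax).
  exists (g x0 - g x); last by rewrite opprB.
  by apply/interior_orthant => i; rewrite !mxE subr_gt0.
move: Hx => [y /interior_orthant y0 yE] i.
by rewrite -subr_gt0 -[_ - _]opprB; have := congr1 (fun M : 'rV_q => M ord0 i) yE;
  rewrite !mxE => <-; rewrite opprK.
Qed.

Lemma SOLsP (R : realType) (n q : nat) (A : set 'rV[R]_n)
    (g : 'rV[R]_n -> 'rV[R]_q) (x0 : 'rV[R]_n) :
  SOLs A g x0 <->
  A x0 /\ forall x, A x -> (forall i, g x ord0 i <= g x0 ord0 i) -> g x = g x0.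
Proof.
split=> -[Ax0 H]; split=> // x Ax.
  move=> le; apply/eqP; rewrite -subr_eq0; apply/negP => /negP/eqP ne.
  apply: (H x Ax); split=> //; exists (g x0 - g x); last by rewrite opprB.
  by move=> i; rewrite !mxE subr_ge0.
move=> [[y y0 yE]] /= ne; apply: ne; apply/eqP; rewrite subr_eq0; apply/eqP.
apply: H => // i; have := congr1 (fun M : 'rV_q => M ord0 i) yE.
rewrite !mxE => E; rewrite -subr_ge0 -[_ - _]opprB -E opprK; exact: y0.
Qed.

(** The value [p 0] is kept, rather than assumed to be 0: in the application [p]
may be a nonzero constant, when [A] is reduced to 0. *)
Lemma SOL_eq_set0P (R : realType) (n : nat) (A : set 'rV[R]_n)
    (p : 'rV[R]_n -> R) : A 0 ->
  SOL A p = [set 0] <-> forall x, A x -> x != 0 -> p 0 < p x.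
Proof.
move=> A0; split=> [E x Ax x0|H].
  have [_ min0] : SOL A p 0 by rewrite E.
  rewrite lt_neqAle min0// andbT; apply: contra x0 => /eqP px; apply/eqP.
  suff : SOL A p x by rewrite E.
  by split=> // y Ay; rewrite -px min0.
apply/seteqP; split=> [x [Ax minx]|_ ->] /=.
  by apply/eqP; apply: contraTT (minx 0 A0) => x0; rewrite -ltNge H.
by split=> // x Ax; have [->|/(H x Ax)/ltW] := eqVneq x 0.
Qed.

(** * Homogeneous vector functions on a closed cone *)

Section homogeneous.
Variables (R : realType) (n q : nat) (C : set 'rV[R]_n).
Variables (g : 'I_q -> 'rV[R]_n -> R) (d : 'I_q -> nat).
Hypotheses (C_closed : closed C) (C0 : C 0).
Hypothesis CZ : forall (a : R) x, 0 < a -> C x -> C (a *: x).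
Hypothesis g_cont : forall i, continuous (g i).
Hypothesis g_homog : forall i t x, g i (t *: x) = t ^+ d i * g i x.
Hypothesis d_ge1 : forall i, (1 <= d i)%N.

Lemma homog0 i : g i 0 = 0.
Proof. by rewrite -(scale0r 0) g_homog expr0n gtn_eqF ?mul0r. Qed.

Let no_nonpos := forall x, C x -> x != 0 -> exists i, 0 < g i x.

(** The sum of the positive parts is continuous and positive on the unit sphere of
[C], hence bounded below there by some [c > 0].  Each degree being at least 1,
scaling a unit vector by [r >= 1] multiplies that sum by at least [r]. *)
Lemma positive_part_coercive : no_nonpos ->
  exists2 c, 0 < c & forall y, C y -> 1 <= `|y| ->
    c * `|y| <= \sum_i Num.max 0 (g i y).
Proof.
move=> pos.
pose h y := \sum_i Num.max 0 (g i y).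
have h_cont : continuous h.
  apply: continuous_sum_fin => i y.
  by apply: (@continuous_max R _ (fun=> 0) (g i));
    [exact: cst_continuous|exact: g_cont].
pose K := C `&` [set y | `|y| = 1].
have norm_unit (y : 'rV[R]_n) : y != 0 -> `|(`|y|^-1 *: y)| = 1.
  by move=> y0; rewrite normrZ normfV normr_id mulVf// normr_eq0.
have C_unit y : C y -> y != 0 -> K (`|y|^-1 *: y).
  by move=> Cy y0; split; [|exact: norm_unit];
    apply: CZ => //; rewrite invr_gt0 normr_gt0.
have ne0 (y : 'rV[R]_n) : 1 <= `|y| -> y != 0.
  by move=> y1; rewrite -normr_gt0 (lt_le_trans ltr01).
have [K0|K0] := pselect (K !=set0); last first.
  (* The cone is reduced to 0: no point has norm at least 1. *)
  exists 1 => // y Cy /ne0 y0; exfalso; apply: K0.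
  by exists (`|y|^-1 *: y); exact: C_unit.
have K_compact : compact K.
  apply: bounded_closed_compact.
    by exists 1; split=> [|M M1 y [_ /= ->]]; [exact: num_real|exact: ltW].
  apply: closedI => //.
  apply: (@preimage_closed _ _ (fun y : 'rV[R]_n => `|y|) [set 1]).
    by move=> y _; exact: norm_continuous.
  exact: closed_eq.
have [u] := compact_EVT_min K0 K_compact (continuous_subspaceT h_cont).
rewrite inE => -[Cu u1] minu.
exists (h u).
  have [i gi] : exists i, 0 < g i u by apply: pos => //; apply: ne0; rewrite u1.
  rewrite /h (bigD1 i)//= ltr_pwDl ?lt_max ?gi ?orbT//.
  by apply: sumr_ge0 => j _; rewrite le_max lexx.
move=> y Cy y1; have y0 := ne0 y y1.
have {}minu : h u <= h (`|y|^-1 *: y) by apply: minu; rewrite inE; exact: C_unit.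
rewrite (le_trans (ler_wpM2r (normr_ge0 y) minu))// mulr_suml.
apply: ler_sum => i _.
set w := _ *: y.
have -> : g i y = `|y| ^+ d i * g i w.
  by rewrite -g_homog scalerA divff ?scale1r// normr_eq0.
have -> : Num.max 0 (`|y| ^+ d i * g i w) = `|y| ^+ d i * Num.max 0 (g i w).
  by rewrite maxr_pMr ?exprn_ge0// mulr0.
rewrite mulrC ler_wpM2r ?le_max ?lexx//.
by rewrite -[leLHS]expr1 ler_weXn2l.
Qed.

(** On the sublevel set the positive parts are at most [`|b i|], so coercivity
bounds the norm. *)
Lemma sublevel_compact (b : 'I_q -> R) : no_nonpos ->
  compact (C `&` \bigcap_(i in [set: 'I_q]) [set y | g i y <= b i]).
Proof.
move=> /positive_part_coercive[c c0 coer]; apply: bounded_closed_compact.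
  exists (Num.max 1 ((\sum_i `|b i|) / c)).
  split=> [|M]; first exact: num_real.
  rewrite gt_max => /andP[M1 bM] y [Cy yb]. rewrite /=.
  have [y1|y1] := leP 1 `|y|; last by rewrite (le_trans (ltW y1))// ltW.
  rewrite (le_trans _ (ltW bM))// ler_pdivlMr// mulrC.
  rewrite (le_trans (coer _ Cy y1))//; apply: ler_sum => i _.
  by rewrite ge_max normr_ge0 (le_trans (yb i I))// ler_norm.
apply: closedI => //; apply: closed_bigI => i _.
apply: (@preimage_closed _ _ (g i) [set z | z <= b i]).
  by move=> y _; exact: g_cont.
exact: closed_le.
Qed.

(** A minimizer of [\sum_i g i] on the compact set of the points of [C] below [x]:
a point strictly dominating it would lie in the same set and have a smaller
sum. *)
Lemma weakly_efficient_below x : (0 < q)%N -> no_nonpos -> C x ->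
  exists z, [/\ C z, forall i, g i z <= g i x &
    forall y, C y -> ~ forall i, g i y < g i z].
Proof.
move=> q0 pos Cx.
have s_cont : continuous (fun y => \sum_i g i y) by exact: continuous_sum_fin.
have [|z] := compact_EVT_min _ (sublevel_compact (b := g^~ x) pos)
  (continuous_subspaceT s_cont); first by exists x; split=> // i _ /=.
rewrite inE => -[Cz zx] minz; exists z; split=> [//|i|y Cy yz].
  exact: zx i I.
have : \sum_i g i z <= \sum_i g i y.
  apply: minz; rewrite inE; split=> // i _ /=.
  exact: le_trans (ltW (yz i)) (zx i I).
rewrite leNgt => /negP; apply; apply: ltr_sum => [|i _]; last exact: yz.
by apply/hasP; exists (Ordinal q0) => //; rewrite mem_index_enum.
Qed.

Let G x : 'rV[R]_q := \row_i g i x.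

(** From left to right, suppose [g i x <= 0] with [x] nonzero.  A weakly efficient
point below a point that strictly dominates [x] has a negative [g i], hence
differs from 0.  Dominating [x] first is what yields a strict inequality when
[g i x = 0]. *)
Lemma SOLw_eq_set0P : (0 < q)%N ->
  SOLw C G = [set 0] <-> forall i x, C x -> x != 0 -> 0 < g i x.
Proof.
move=> q0; split=> [E|pos].
  have weak x : C x -> (forall y, C y -> ~ forall i, g i y < g i x) -> x = 0.
    move=> Cx xmin; suff : SOLw C G x by rewrite E.
    apply/SOLwP; split=> // y Cy yx; apply: (xmin y Cy) => i.
    by have := yx i; rewrite !mxE.
  have [_ weak0] : C 0 /\ forall y, C y -> ~ forall i, g i y < g i 0.
    have /SOLwP[_ w0] : SOLw C G 0 by rewrite E.
    by split=> // y Cy y0; apply: (w0 y Cy) => i; rewrite !mxE.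
  (* A point of [C] where all [g i] are nonpositive is weakly efficient, since
     what strictly dominates it strictly dominates 0. *)
  have nn : no_nonpos.
    move=> x Cx x0; apply: contrapT => nopos.
    case/eqP: x0; apply: weak => // y Cy yx; apply: (weak0 y Cy) => i.
    rewrite homog0 (lt_le_trans (yx i))// leNgt; apply/negP => gi.
    by apply: nopos; exists i.
  move=> i x Cx x0; rewrite ltNge; apply/negP => gx.
  have [y [Cy yx]] : exists y, C y /\ forall j, g j y < g j x.
    apply: contrapT => noy; case/eqP: x0; apply: weak => // y Cy yx.
    by apply: noy; exists y.
  have [z [Cz zy zweak]] := weakly_efficient_below q0 nn Cy.
  have := le_lt_trans (zy i) (lt_le_trans (yx i) gx).
  by rewrite (weak z Cz zweak) homog0 ltxx.
apply/seteqP; split=> [x /SOLwP[Cx xweak]|_ ->] /=.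
  apply: contrapT => /eqP x0; apply: (xweak 0 C0) => i.
  by rewrite !mxE homog0 pos.
apply/SOLwP; split=> // x Cx gx.
have := gx (Ordinal q0); rewrite !mxE homog0.
have [->|x0] := eqVneq x 0; first by rewrite homog0 ltxx.
by rewrite ltNge ltW// pos.
Qed.

(** Every point of [C] is at least as good as 0, so efficiency of 0 forces [g] to
vanish on [C], which makes every point of [C] efficient. *)
Lemma SOLs_eq_set0P : (forall i x, C x -> g i x <= 0) ->
  SOLs C G = [set 0] <-> forall x, C x -> x = 0.
Proof.
move=> g_le0; split=> [E|Ctriv].
  have /SOLsP[_ eff0] : SOLs C G 0 by rewrite E.
  have GC x : C x -> G x = G 0.
    by move=> Cx; apply: eff0 => // i; rewrite !mxE homog0 g_le0.
  move=> x Cx; suff : SOLs C G x by rewrite E.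
  by apply/SOLsP; split=> // y Cy _; rewrite !GC.
apply/seteqP; split=> [x /SOLsP[/Ctriv]//|_ ->] /=.
by apply/SOLsP; split=> // x /Ctriv ->.
Qed.

End homogeneous.

(** * Scalarization *)

(** With [D] the largest degree among the [f i] of nonzero weight, the degree [D]
part of the sum at [x] collects only nonnegative contributions: positive from
the [f i] of degree [D], null from those of smaller degree.  Its positivity shows
at once that [D] is the degree of the sum and that the conclusion holds. *)
Lemma scalarization_gt0 (R : realType) (n q : nat) (C : set 'rV[R]_n)
    (f : 'I_q -> mpoly.mpoly n R) (lambda : 'rV[R]_q) :
  (forall i, 1 <= pdeg (f i))%N ->
  (forall i x, C x -> x != 0 -> 0 < pinf (f i) (pdeg (f i)) x) ->
  (@orthant R q `\ 0) lambda ->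
  let p := \sum_(i < q) lambda ord0 i *: f i in
  forall x, C x -> x != 0 -> pinf p (pdeg p) 0 < pinf p (pdeg p) x.
Proof.
move=> d_ge1 pos [l_ge0 l0] p x Cx x0.
have [k lk] : exists k, lambda ord0 k != 0.
  apply: contrapT => H; apply: l0; apply/rowP => k; rewrite mxE.
  by apply: contrapT => /eqP lk; apply: H; exists k.
have /(eq_bigmax_cond (fun i => pdeg (f i)))[i0 li0 ED] :
  (0 < #|[pred i | lambda ord0 i != 0%R]|)%N by apply/card_gt0P; exists k.
set D := (\max_(i in _) _)%N in ED.
have d_le i : lambda ord0 i != 0 -> (pdeg (f i) <= D)%N.
  by move=> li; exact: (@leq_bigmax_cond _ _ (fun i => pdeg (f i)) i li).
have pE y : peval (mpoly.pihomog mpoly.mdeg D p) y =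
    \sum_i lambda ord0 i * peval (mpoly.pihomog mpoly.mdeg D (f i)) y.
  rewrite [mpoly.pihomog _ _ _]linear_sum /peval raddf_sum.
  apply: eq_bigr => i _.
  by rewrite /= [mpoly.pihomog _ _ (_ *: _)]linearZ mpoly.mevalZ.
have term_ge0 i : 0 <= lambda ord0 i * peval (mpoly.pihomog mpoly.mdeg D (f i)) x.
  have [->|li] := eqVneq (lambda ord0 i) 0; first by rewrite mul0r.
  apply: mulr_ge0; first exact: l_ge0.
  have := d_le i li; rewrite leq_eqVlt => /predU1P[<-|lt].
    by rewrite -pinfE// ltW// pos.
  by rewrite pihomog_gt_pdeg// /peval raddf0.
have px : 0 < peval (mpoly.pihomog mpoly.mdeg D p) x.
  rewrite pE (bigD1 i0)//= ltr_pwDl//; last by apply: sumr_ge0 => i _.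
  apply: mulr_gt0.
    by rewrite lt_neqAle eq_sym l_ge0 andbT; move: li0; rewrite inE.
  by rewrite ED -pinfE// pos.
(* A degree below [D] would make the degree [D] part of [p] vanish at [x]. *)
have -> : pdeg p = D.
  apply/eqP; rewrite eqn_leq pdeg_sum_scale//= leqNgt; apply/negP => lt.
  by move: px; rewrite pihomog_gt_pdeg// /peval raddf0 ltxx.
have pD : (pdeg p <= D)%N by exact: pdeg_sum_scale.
rewrite !pinfE// -(scale0r 0) peval_pihomogZ expr0n gtn_eqF ?mul0r//.
by rewrite ED.
Qed.

Lemma sum_delta_scale (R : realType) (n q : nat) (f : 'I_q -> mpoly.mpoly n R)
    (i : 'I_q) :
  \sum_(j < q) (delta_mx ord0 i : 'rV[R]_q) ord0 j *: f j = f i.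
Proof.
rewrite (bigD1 i)//= mxE !eqxx scale1r big1 ?addr0// => j ji.
by rewrite mxE (negbTE ji) andbF scale0r.
Qed.

Lemma delta_in_orthant (R : realType) (q : nat) (i : 'I_q) :
  (@orthant R q `\ 0) (delta_mx ord0 i).
Proof.
split=> [j|/rowP/(_ i)/eqP]; first by rewrite mxE ler0n.
by rewrite !mxE !eqxx oner_eq0.
Qed.

Theorem theorem5 (R : realType) (n q : nat) (q_gt0 : (0 < q)%N)
    (f : 'I_q -> mpoly.mpoly n R) (d : 'I_q -> nat)
    (deg_f : forall i, pdeg (f i) = d i) (d_ge1 : forall i, (1 <= d i)%N)
    (S : set 'rV[R]_n) (S_neq0 : S !=set0) (S_closed : closed S) :
  let Sinf := asymptotic_cone S in
  let scal (lambda : 'rV[R]_q) := \sum_(i < q) lambda ord0 i *: f i in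
  let SOLscal lambda := SOL Sinf (pinf (scal lambda) (pdeg (scal lambda))) in
  let Ci := SOLw Sinf (vinf f d) = [set 0] in
  let Cii := forall i, SOL Sinf (pinf (f i) (d i)) = [set 0] in
  let Ciii := forall lambda : 'rV[R]_q,
    (@orthant R q `\ 0) lambda -> SOLscal lambda = [set 0] in
  let Civ := SOLs Sinf (vinf f d) = [set 0] in
  let cone_cond := Sinf `<=` [set x | vle (vinf f d x) 0] in
  [/\ (Ci <-> Cii) /\ (Cii <-> Ciii),
      cone_cond -> [/\ Ci <-> Civ, Cii <-> Civ & Ciii <-> Civ] &
      [\/ Ci, Cii, Ciii | cone_cond /\ Civ] ->
        exists2 lambda : 'rV[R]_q,
          (@orthant R q `\ 0) lambda & SOLscal lambda = [set 0]].
Proof.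
move=> Sinf scal SOLscal Ci Cii Ciii Civ cone_cond.
pose g i x := pinf (f i) (d i) x.
have gE i : g i = peval (mpoly.pihomog mpoly.mdeg (d i) (f i)).
  by apply/funext => x; rewrite /g pinfE// deg_f.
have g_cont i : continuous (g i) by rewrite gE; exact: peval_continuous.
have g_homog i (t : R) x : g i (t *: x) = t ^+ d i * g i x.
  by rewrite gE peval_pihomogZ.
have Sinf_closed : closed Sinf by exact: asymptotic_cone_closed.
have Sinf0 : Sinf 0 by exact: asymptotic_cone0.
have SinfZ (a : R) x : 0 < a -> Sinf x -> Sinf (a *: x).
  exact: asymptotic_coneZ.
pose pos := forall i x, Sinf x -> x != 0 -> 0 < g i x.
have CiP : Ci <-> pos.
  exact: (SOLw_eq_set0P Sinf_closed Sinf0 SinfZ g_cont g_homog d_ge1 q_gt0).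
have CiiP : Cii <-> pos.
  split=> H i; last by apply/SOL_eq_set0P => // x Sx x0;
    rewrite -!/(g i _) (homog0 g_homog d_ge1) H.
  have /SOL_eq_set0P := H i => /(_ Sinf0) Hi x Sx x0.
  by rewrite -(homog0 g_homog d_ge1 i) Hi.
have scal_delta i : scal (delta_mx ord0 i) = f i by exact: sum_delta_scale.
have CiiiP : Ciii <-> pos.
  rewrite -CiiP; split=> [H i|/CiiP H lambda l0].
    by have := H _ (delta_in_orthant R i); rewrite /SOLscal scal_delta deg_f.
  apply/SOL_eq_set0P => //; apply: scalarization_gt0 l0 => // [i|i x].
    by rewrite deg_f.
  by rewrite deg_f; exact: H.
have CivP : cone_cond -> (Civ <-> pos).
  move=> cc.
  have g_le0 i x : Sinf x -> g i x <= 0.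
    by move=> /cc/(_ i); rewrite !mxE sub0r oppr_ge0.
  rewrite /Civ (SOLs_eq_set0P Sinf0 g_homog d_ge1 g_le0); split.
    by move=> H i x /H ->; rewrite eqxx.
  move=> H x Sx; apply: contrapT => /eqP x0.
  by have := H (Ordinal q_gt0) x Sx x0; rewrite ltNge g_le0.
split.
- by rewrite CiP CiiP CiiiP.
- by move=> /CivP E; split; rewrite ?CiP ?CiiP ?CiiiP E.
- move=> H; have /CiiiP Hiii : pos.
    by case: H => [/CiP|/CiiP|/CiiiP|[/CivP E /E]].
  by exists (delta_mx ord0 (Ordinal q_gt0)); [|apply: Hiii];
    exact: delta_in_orthant.
Qed.
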